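(* For a fixed integer $k$, there are only finitely many acyclic quivers $Q$ with Markov invariant $M_Q=k$ (and hence only finitely many acyclic quivers with the same Alexander polynomial). In particular, if $Q$ is an acyclic quiver on $n$ vertices with $M_Q=n-1$ and $Q$ is connected, then $Q$ is mutation equivalent to a quiver whose underlying undirected graph is a tree (with no parallel arrows).
   Context: A quiver is a finite directed graph with parallel edges (arrows) allowed and no oriented cycles of length 1 or 2; all vertices are mutable. It is acyclic if it has no directed cycles, and connected if its underlying undirected graph is connected. Write $u\to v$ if there is at least one arrow from $u$ to $v$. Exchange matrix: $B_Q=(b_{uv})$, $b_{uv}=\#\{\text{arrows }u\to v\}-\#\{\text{arrows }v\to u\}$. Mutation $\mu_v(Q)$ at a vertex $v$: (1) for each oriented path $u\to v\to w$ add a new arrow $u\to w$ (with multiplicity); (2) reverse all arrows incident to $v$; (3) remove oriented 2-cycles one at a time until none remain. Two quivers are mutation equivalent if they are related by a sequence of mutations. For a linear order $<$ on the vertices of $Q$, the unipotent companion of $(Q,<)$ is the unipotent upper triangular matrix $U$ with $U^T-U=B_Q$, rows and columns written in the order $<$. For an acyclic quiver $Q$, let $n$ denote its number of vertices and take any linear order $<$ such that $u<v$ whenever $u\to v$; the Alexander polynomial of $Q$ is $\Delta_Q(t)=\det(tU-U^T)$ and the Markov invariant is $M_Q=n+(\text{coefficient of }t^{n-1}\text{ in }\Delta_Q(t))$. These do not depend on the choice of such an order.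
   Formalization: Read literally, finiteness for fixed M_Q=k fails (isolated vertices do not change M_Q; all edgeless quivers have M_Q=0); it is stated up to isomorphism and adding isolated vertices, and, for each fixed number of vertices, up to isomorphism. *)

(* Defs.v *)
(* A quiver is given by its arrow multiplicities: the individual arrows carry no
   names. *)
From HB Require Import structures.
From mathcomp Require Import all_boot all_order all_algebra perm.

Set Implicit Arguments.
Unset Strict Implicit.
Unset Printing Implicit Defensive.

Import Order.TTheory GRing.Theory Num.Theory.
Local Open Scope ring_scope.

(* arrows Q u v is the number of arrows u -> v.  The case u = v of the side
   condition forbids loops. *)
Record quiver (V : finType) := Quiver {
  arrows :> {ffun V -> {ffun V -> nat}};
  _ : [forall u, forall v, (arrows u v == 0)%N || (arrows v u == 0)%N]
}.

HB.instance Definition _ (V : finType) := [isSub for @arrows V].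
HB.instance Definition _ (V : finType) := [Equality of quiver V by <:].

Definition arrow (V : finType) (Q : quiver V) : rel V :=
  [rel u v | (0 < Q u v)%N].

Definition adjacent (V : finType) (Q : quiver V) : rel V :=
  [rel u v | arrow Q u v || arrow Q v u].

Definition acyclic (V : finType) (Q : quiver V) : Prop :=
  forall c : seq V, cycle (arrow Q) c -> c = [::].

Definition connected (V : finType) (Q : quiver V) : Prop :=
  (0 < #|V|)%N /\ forall u v : V, connect (adjacent Q) u v.

(* The underlying graph is a tree without parallel edges.  A simple closed walk
   of size 2 in the sense of ucycle is just one edge traversed back and
   forth. *)
Definition is_tree (V : finType) (Q : quiver V) : Prop :=
  [/\ connected Q,
      forall c : seq V, ucycle (adjacent Q) c -> (size c <= 2)%N
    & forall u v : V, (Q u v <= 1)%N].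

Section Mutation.
Variables (V : finType) (Q : quiver V) (v : V).

Definition mut_compose (u w : V) : nat := (Q u w + Q u v * Q v w)%N.

Definition mut_reverse (u w : V) : nat :=
  if (u == v) || (w == v) then mut_compose w u else mut_compose u w.

(* truncated subtraction: cancels the oriented 2-cycles between u and w *)
Definition mut_arrows : {ffun V -> {ffun V -> nat}} :=
  [ffun u => [ffun w => (mut_reverse u w - mut_reverse w u)%N]].

Fact mut_arrows_subproof :
  [forall u, forall w,
     (mut_arrows u w == 0)%N || (mut_arrows w u == 0)%N].
Proof.
apply/forallP => u; apply/forallP => w; rewrite !ffunE !subn_eq0.
exact: leq_total.
Qed.

Definition mutation : quiver V := Quiver mut_arrows_subproof.

End Mutation.

(* Mutation at a vertex is an involution, so this relation is symmetric. *)
Definition mutation_equivalent (V : finType) (Q Q' : quiver V) : Prop :=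
  exists s : seq V, foldl (@mutation V) Q s = Q'.

Definition exchange (V : finType) (Q : quiver V) (u v : V) : int :=
  (Q u v)%:Z - (Q v u)%:Z.

(* A linear order on V is given by the duplicate-free list s of all vertices in
   increasing order. *)
Definition exchange_mx (V : finType) (Q : quiver V) (s : #|V|.-tuple V) :
    'M[int]_#|V| :=
  \matrix_(i, j) exchange Q (tnth s i) (tnth s j).

Definition companion (V : finType) (Q : quiver V) (s : #|V|.-tuple V) :
    'M[int]_#|V| :=
  \matrix_(i, j) (if i == j then 1
                  else if (i < j)%N then - exchange Q (tnth s i) (tnth s j)
                  else 0).

Lemma companionP (V : finType) (Q : quiver V) (s : #|V|.-tuple V)
    (U : 'M[int]_#|V|) :
  [/\ forall i, U i i = 1,
      forall i j : 'I_#|V|, (j < i)%N -> U i j = 0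
    & U^T - U = exchange_mx Q s] <-> U = companion Q s.
Proof.
split=> [[U1 U0 UB]|->].
  apply/matrixP => i j; rewrite mxE; case: eqVneq => [->|nij]; first exact: U1.
  case: ltnP => ij; last first.
    by apply: U0; rewrite ltn_neqAle ij andbT eq_sym.
  have /matrixP/(_ i j) := UB; rewrite !mxE (U0 _ _ ij) sub0r => <-.
  by rewrite opprK.
split=> [i|i j ji|]; first by rewrite mxE eqxx.
  by rewrite mxE -val_eqE /= gtn_eqF // ltnNge (ltnW ji).
apply/matrixP => i j; rewrite !mxE.
rewrite [j == i]eq_sym; case: eqVneq => [->|nij]; first by rewrite /exchange !subrr.
case: ltngtP => ij.
- by rewrite subr0 /exchange opprB.
- by rewrite sub0r opprK.
- by move: nij; rewrite -val_eqE /= ij eqxx.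
Qed.

Definition admissible (V : finType) (Q : quiver V) (s : #|V|.-tuple V) : bool :=
  uniq s && [forall i : 'I_#|V|, forall j : 'I_#|V|,
               arrow Q (tnth s i) (tnth s j) ==> (i < j)%N].

Definition alexander_wrt (V : finType) (Q : quiver V) (s : #|V|.-tuple V) :
    {poly int} :=
  let U := companion Q s in
  \det ('X *: map_mx polyC U - map_mx polyC U^T).

(* Some admissible order is picked; for acyclic quivers there is one, and the
   choice is irrelevant (acyclic_admissible and alexanderE below).  The default
   value 0 is only taken by quivers with an oriented cycle. *)
Definition alexander (V : finType) (Q : quiver V) : {poly int} :=
  if [pick s | admissible Q s] is Some s then alexander_wrt Q s else 0.

(* There is no t^(n-1) when n = 0. *)
Definition markov (V : finType) (Q : quiver V) : int :=
  #|V|%:Z + (if #|V| is m.+1 then (alexander Q)`_m else 0).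

Lemma acyclic_admissible (V : finType) (Q : quiver V) :
  acyclic Q -> exists s, admissible Q s.
Proof.
move=> acQ; pose g v := #|[pred u | connect (arrow Q) u v]|.
have g_lt u v : arrow Q u v -> (g u < g v)%N.
  move=> uv; apply/proper_card/properP; split.
    apply/subsetP => x; rewrite !inE => xu.
    exact: connect_trans xu (connect1 uv).
  exists v; rewrite !inE ?connect0 //; apply/negP => /connectP[p pth eu].
  by have := acQ (v :: p); rewrite /= rcons_path pth -eu uv => /(_ isT).
pose s := sort (relpre g leq) (enum V).
have sz : size s == #|V| by rewrite size_sort -cardE.
exists (Tuple sz); apply/andP; split; first by rewrite /= sort_uniq enum_uniq.
apply/forallP => i; apply/forallP => j; apply/implyP => /g_lt.
have [x0 _] : exists x0 : V, True by exists (tnth (Tuple sz) i).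
rewrite !(tnth_nth x0) /= => gij; rewrite ltnNge.
apply: contraTN gij => ji; rewrite -leqNgt.
have ss : sorted (relpre g leq) s by apply: sort_sorted => x y; apply: leq_total.
apply: (sorted_leq_nth _ _ _ ss) ji => //.
- by move=> x y z; apply: leq_trans.
- by move=> x; apply: leqnn.
- by rewrite inE (eqP sz).
- by rewrite inE (eqP sz).
Qed.

Lemma companion_admissible (V : finType) (Q : quiver V) (s : #|V|.-tuple V) :
  admissible Q s ->
  companion Q s =
    \matrix_(i, j) ((i == j)%:R - (Q (tnth s i) (tnth s j))%:Z).
Proof.
case/andP=> _ /forallP adm; apply/matrixP => i j; rewrite !mxE.
have noarr (k l : 'I_#|V|) : (l <= k)%N -> Q (tnth s k) (tnth s l) = 0%N.
  move=> lk; have /forallP/(_ l) := adm k; rewrite ltnNge lk implybF -eqn0Ngt.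
  by move/eqP.
case: eqVneq => [->|nij]; first by rewrite noarr // subr0.
case: ltnP => ij; last by rewrite noarr // subr0.
by rewrite /exchange (noarr _ _ (ltnW ij)) subr0 sub0r.
Qed.

Lemma alexander_wrt_indep (V : finType) (Q : quiver V) (s s' : #|V|.-tuple V) :
  admissible Q s -> admissible Q s' -> alexander_wrt Q s = alexander_wrt Q s'.
Proof.
move=> As As'; rewrite /alexander_wrt !companion_admissible //.
case/andP: As => us _; case/andP: As' => us' _.
have inj t : uniq (t : #|V|.-tuple V) -> injective (tnth t) by move/tuple_uniqP.
have mem (v : V) : v \in s'.
  have sub : {subset s' <= enum V} by move=> x _; rewrite mem_enum.
  have [|_ ->] := uniq_min_size us' sub; last by rewrite mem_enum.
  by rewrite -cardE size_tuple.
pose f i := sval (sig_eqW (tnthP _ _ (mem (tnth s i)))).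
have fE i : tnth s' (f i) = tnth s i by rewrite /f; case: sig_eqW.
have f_inj : injective f by move=> i j e; apply: (inj _ us); rewrite -!fE e.
pose p := perm f_inj.
set A := (X in _ = \det X).
have -> : forall B, B = row_perm p (col_perm p A) -> \det B = \det A => //.
  move=> B ->; rewrite row_permE col_permE !det_mulmx !det_perm.
  by rewrite mulrCA odd_permV -signr_addb addbb mulr1.
by apply/matrixP => i j; rewrite !mxE !permE !fE !(inj_eq f_inj).
Qed.

Lemma alexanderE (V : finType) (Q : quiver V) (s : #|V|.-tuple V) :
  admissible Q s -> alexander Q = alexander_wrt Q s.
Proof.
move=> As; rewrite /alexander; case: pickP => [s' As'|/(_ s)]; last by rewrite As.
exact: alexander_wrt_indep.
Qed.

Definition quiver_iso (V W : finType) (Q : quiver V) (Q' : quiver W) : Prop :=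
  exists2 f : V -> W, bijective f & forall u v, Q' (f u) (f v) = Q u v.

(* Q' is isomorphic to the disjoint union of Q and some isolated vertices *)
Definition adds_isolated (V W : finType) (Q : quiver V) (Q' : quiver W) : Prop :=
  exists f : V -> W,
    [/\ injective f,
        forall u v, Q' (f u) (f v) = Q u v
      & forall x y, arrow Q' x y -> x \in codom f /\ y \in codom f].

(* Every finite vertex set is in bijection with some 'I_n, so representatives are
   taken there; the quantification over V runs over all finite vertex sets. *)
Definition finitely_many_modulo
    (R : forall V W : finType, quiver V -> quiver W -> Prop)
    (P : forall V : finType, quiver V -> Prop) : Prop :=
  exists s : seq {n : nat & quiver 'I_n},
  forall (V : finType) (Q : quiver V), P V Q ->
    exists2 Q0, Q0 \in s & R _ _ (tagged Q0) Q.

(* Main.v *)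
Require Import Defs.
From HB Require Import structures.
From mathcomp Require Import all_boot all_order all_algebra.

Set Implicit Arguments.
Unset Strict Implicit.
Unset Printing Implicit Defensive.

Import Order.TTheory GRing.Theory Num.Theory.
Local Open Scope ring_scope.

(** With respect to an admissible order the companion of an acyclic quiver is
    [U = 1 - N], where [N] is the strictly upper triangular matrix of arrow
    multiplicities. Since [det U = 1], the Alexander polynomial is the
    characteristic polynomial of [U^-1 U^T], so its coefficient of [t^(n-1)] is
    [- tr (U^-1 U^T) = - n + \sum_(i, j) (U^-1)_ij N_ij]. Hence
    [M_Q = \sum_(i, j) P_ij N_ij], where [P = U^-1 = 1 + N + N^2 + ...] counts
    directed paths. In particular [P_ij >= N_ij], and the Markov invariant
    bounds the sum of the squares of all the arrow multiplicities
    ([sum_sqr_le_markov]).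

    Finiteness follows: if [M_Q = k] then at most [2 k] vertices are not
    isolated and every multiplicity is at most [k]. With the number of vertices
    prescribed there are finitely many quivers up to isomorphism, and the
    Alexander polynomial determines the number of vertices, which is its degree,
    as well as [M_Q].

    If [M_Q = n - 1] and [Q] is connected, then at least [n - 1] pairs of
    vertices are joined by arrows, so the bound is attained: there are exactly
    [n - 1] such pairs, each joined by one arrow ([connected_is_tree]). Thus [Q]
    is itself a tree and the empty sequence of mutations will do. *)

(** * The inverse of a unipotent upper triangular matrix *)

Section Unipotent.
Variables (n : nat) (N : 'M[int]_n).
Hypothesis N_triu : forall i j : 'I_n, (j <= i)%N -> N i j = 0.

Let U : 'M[int]_n := 1%:M - N.

Lemma det_unipotent : \det U = 1.
Proof.
rewrite -det_tr det_trig.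
  by apply: big1 => i _; rewrite !mxE eqxx N_triu ?subr0.
apply/is_trig_mxP => i j lt_ij.
by rewrite !mxE N_triu 1?ltnW // -val_eqE /= gtn_eqF ?subr0.
Qed.

Let P := invmx U.

Lemma unipotent_unitmx : U \in unitmx.
Proof. by rewrite unitmxE det_unipotent unitr1. Qed.

(** [P i j] counts the paths from [i] to [j], for [N] an adjacency matrix; the
    sum runs over the last arrow of the path. As [N k j] vanishes unless
    [k < j], properties of column [j] follow from those of earlier columns. *)
Lemma inv_unipotent_rec i j : P i j = (i == j)%:R + \sum_k P i k * N k j.
Proof.
have /matrixP/(_ i j) : P *m U = 1%:M by rewrite mulVmx // unipotent_unitmx.
by rewrite mulmxBr mulmx1 !mxE => <-; rewrite subrK.
Qed.

Lemma inv_unipotent_triu (i j : 'I_n) : (j < i)%N -> P i j = 0.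
Proof.
elim/ltn_ind: {j}(val j) {-2}j (erefl (val j)) => m IHm j eq_jm lt_ji.
rewrite inv_unipotent_rec -val_eqE /= gtn_eqF // add0r big1 // => k _.
have [le_jk|lt_kj] := leqP j k; first by rewrite N_triu ?mulr0.
by rewrite (IHm k) ?mul0r // -?eq_jm // (ltn_trans lt_kj).
Qed.

Lemma inv_unipotent_diag i : P i i = 1.
Proof.
rewrite inv_unipotent_rec eqxx big1 ?addr0 // => k _.
have [le_ik|lt_ki] := leqP i k; first by rewrite N_triu ?mulr0.
by rewrite inv_unipotent_triu ?mul0r.
Qed.

Lemma tr_inv_unipotent_mul_tr :
  \tr (P *m U^T) = n%:R - \sum_i \sum_j P i j * N i j.
Proof.
rewrite /U linearB /= trmx1 mulmxBr mulmx1 linearB /=; congr (_ - _).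
  rewrite /mxtrace (eq_bigr (fun=> 1)) => [|i _]; last exact: inv_unipotent_diag.
  by rewrite sumr_const card_ord.
by apply: eq_bigr => i _; rewrite mxE; apply: eq_bigr => j _; rewrite mxE.
Qed.

Hypothesis N_ge0 : forall i j, 0 <= N i j.

Lemma inv_unipotent_ge0 i j : 0 <= P i j.
Proof.
elim/ltn_ind: {j}(val j) {-2}j (erefl (val j)) => m IHm j eq_jm.
rewrite inv_unipotent_rec addr_ge0 ?ler0n // sumr_ge0 // => k _.
have [le_jk|lt_kj] := leqP j k; first by rewrite N_triu ?mulr0.
by rewrite mulr_ge0 // (IHm k) // -eq_jm.
Qed.

(** An arrow is a path: among the terms of the recursion for [P i j], the one
    with [k = i] is [P i i * N i j = N i j]. *)
Lemma inv_unipotent_ge i j : N i j <= P i j.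
Proof.
rewrite inv_unipotent_rec (bigD1 i) //= inv_unipotent_diag mul1r addrCA lerDl.
rewrite addr_ge0 ?ler0n // sumr_ge0 // => k _.
by rewrite mulr_ge0 ?inv_unipotent_ge0.
Qed.

End Unipotent.

(** * The Markov invariant bounds the arrow multiplicities *)

(** Factor [U] out of [t U - U^T]. *)
Lemma det_tsub_charpoly n (U : 'M[int]_n) :
  \det U = 1 ->
  \det ('X *: map_mx polyC U - map_mx polyC U^T) = char_poly (invmx U *m U^T).
Proof.
move=> detU; have uU : U \in unitmx by rewrite unitmxE detU unitr1.
rewrite /char_poly /char_poly_mx.
have -> : 'X *: map_mx polyC U - map_mx polyC U^T =
    map_mx polyC U *m ('X%:M - map_mx polyC (invmx U *m U^T)).
  by rewrite mulmxBr mul_mx_scalar -map_mxM mulmxA mulmxV // mul1mx.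
by rewrite det_mulmx det_map_mx detU mul1r.
Qed.

Lemma coef_char_poly_trace n (A : 'M[int]_n) :
  (if n is m.+1 then (char_poly A)`_m else 0) = - \tr A.
Proof.
case: n A => [|n] A; first by rewrite /mxtrace big_ord0 oppr0.
exact: char_poly_trace.
Qed.

Section Acyclic.
Variables (V : finType) (Q : quiver V).

Definition arrow_mx (s : #|V|.-tuple V) : 'M[int]_#|V| :=
  \matrix_(i, j) (Q (tnth s i) (tnth s j))%:Z.

Lemma arrow_mx_triu s : admissible Q s ->
  forall i j : 'I_#|V|, (j <= i)%N -> arrow_mx s i j = 0.
Proof.
case/andP=> _ /forallP adm i j le_ji; rewrite mxE.
have /forallP/(_ j) := adm i; rewrite ltnNge le_ji implybF -eqn0Ngt.
by move/eqP->.
Qed.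

Lemma companion_arrow_mx s :
  admissible Q s -> companion Q s = 1%:M - arrow_mx s.
Proof.
by move/companion_admissible->; apply/matrixP => i j; rewrite !mxE.
Qed.

Lemma alexander_char_poly s : admissible Q s ->
  let U := 1%:M - arrow_mx s in alexander Q = char_poly (invmx U *m U^T).
Proof.
move=> As /=; rewrite (alexanderE As) /alexander_wrt companion_arrow_mx //.
exact: det_tsub_charpoly (det_unipotent (arrow_mx_triu As)).
Qed.

Lemma size_alexander : acyclic Q -> size (alexander Q) = #|V|.+1.
Proof.
by case/acyclic_admissible=> s As; rewrite (alexander_char_poly As) size_char_poly.
Qed.

Lemma markov_paths s : admissible Q s ->
  let N := arrow_mx s in
  markov Q = \sum_i \sum_j invmx (1%:M - N) i j * N i j.
Proof.
move=> As /=; have trE := tr_inv_unipotent_mul_tr (arrow_mx_triu As).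
rewrite /markov (alexander_char_poly As).
by rewrite coef_char_poly_trace trE opprB natz addrC subrK.
Qed.

Lemma sum_tnth_uniq (s : #|V|.-tuple V) (F : V -> nat) :
  uniq s -> (\sum_i F (tnth s i) = \sum_v F v)%N.
Proof.
move/tuple_uniqP/inj_card_bij=> s_bij.
by rewrite [RHS](reindex (tnth s)) //; apply/onW_bij/s_bij; rewrite card_ord.
Qed.

Lemma sum_sqr_le_markov :
  acyclic Q -> (\sum_u \sum_v Q u v ^ 2)%N%:Z <= markov Q.
Proof.
case/acyclic_admissible=> s As; have /andP[us _] := As.
rewrite (markov_paths As) -(sum_tnth_uniq _ us) -natz natr_sum.
apply: ler_sum => i _; rewrite -(sum_tnth_uniq _ us) natr_sum.
apply: ler_sum => j _; rewrite natz.
have N_ge0 k l : 0 <= arrow_mx s k l by rewrite mxE.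
have := inv_unipotent_ge (arrow_mx_triu As) N_ge0 i j.
by move/(ler_wpM2r (N_ge0 i j)); apply: le_trans; rewrite mxE -PoszM -mulnn.
Qed.

End Acyclic.

Definition arrow_set (V : finType) (Q : quiver V) : {set V * V} :=
  [set p | arrow Q p.1 p.2].

Lemma arrow_leqif_sqr (V : finType) (Q : quiver V) :
  (#|arrow_set Q| <= \sum_u \sum_v Q u v ^ 2
    ?= iff [forall p : V * V, Q p.1 p.2 <= 1])%N.
Proof.
rewrite pair_big /= -sum1_card big_mkcond /=.
apply: leqif_sum => -[u v] _; rewrite inE /arrow /=; apply/leqifP.
by case: (Q u v) => [|[|q]] //=; rewrite ltn_exp2l.
Qed.

Lemma mult_le_sqr (V : finType) (Q : quiver V) u v :
  (Q u v <= \sum_u \sum_v Q u v ^ 2)%N.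
Proof.
rewrite (bigD1 u) //= (bigD1 v) //= -addnA (leq_trans _ (leq_addr _ _)) //.
by case: (Q u v) => // q; rewrite -mulnn leq_pmull.
Qed.

(** * Connected quivers with few arrows are trees *)

Section Tree.
Variables (V : finType) (e : rel V) (r : V).
Hypothesis e_conn : forall v, connect e r v.

(** Take for [d] the distance from [r] and for [par v] the last vertex but one
    on a shortest path to [v]. *)
Lemma connect_parent :
  exists (d : V -> nat) (par : V -> V),
    forall v, v != r -> e (par v) v /\ (d (par v) < d v)%N.
Proof.
pose reach v k := [exists p : k.-tuple V, path e r p && (last r p == v)].
have reachP v : exists k, reach v k.
  have /connectP[p e_p ->] := e_conn v.
  by exists (size p); apply/existsP; exists (in_tuple p); rewrite e_p eqxx.
pose d v := ex_minn (reachP v).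
suff exw v : exists w, (v != r) ==> e w v && (d w < d v)%N.
  exists d, (fun v => xchoose (exw v)) => v v_r.
  by have /implyP/(_ v_r)/andP[] := xchooseP (exw v).
have [_|v_r] := eqVneq v r; first by exists r.
have : reach v (d v) by rewrite /d; case: ex_minnP.
case/existsP=> -[p /= /eqP size_p] /andP[].
case/lastP: p size_p => [_ _|p x]; first by rewrite /= eq_sym (negPf v_r).
rewrite size_rcons last_rcons rcons_path => size_p /andP[e_p e_x] /eqP eq_xv.
exists (last r p); rewrite -eq_xv e_x /= eq_xv -size_p ltnS.
rewrite {1}/d; case: ex_minnP => k _; apply.
by apply/existsP; exists (in_tuple p); rewrite e_p eqxx.
Qed.

End Tree.

Section ParentEdges.
Variables (V : finType) (Q : quiver V) (r : V) (d : V -> nat) (par : V -> V).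
Hypothesis parP : forall v, v != r -> adjacent Q (par v) v /\ (d (par v) < d v)%N.

Definition parent_edge v := if arrow Q (par v) v then (par v, v) else (v, par v).

Lemma parent_edge_in v : v != r -> parent_edge v \in arrow_set Q.
Proof.
case/parP=> adj _; rewrite inE /parent_edge.
by case: ifP adj => //= no_pv /orP[|//]; rewrite no_pv.
Qed.

(** Of the two endpoints of an edge, only the one farther from [r] can have the
    other as its parent. *)
Lemma parent_edge_inj : {in [set~ r] &, injective parent_edge}.
Proof.
move=> u v; rewrite !inE => /parP[_ du] /parP[_ dv].
have no_swap : u = par v -> par u = v -> u = v.
  move=> eq_u eq_v; move: du dv; rewrite eq_v -eq_u => /ltn_trans du /du.
  by rewrite ltnn.
rewrite /parent_edge.
by case: ifP => _; case: ifP => _ [] // *; apply: no_swap.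
Qed.

Lemma sub_parent_edges : parent_edge @: [set~ r] \subset arrow_set Q.
Proof.
by apply/subsetP => _ /imsetP[v + ->]; rewrite !inE => /parent_edge_in; rewrite inE.
Qed.

Lemma card_parent_edges : #|parent_edge @: [set~ r]| = #|V|.-1.
Proof. by rewrite (card_in_imset parent_edge_inj) cardsC1. Qed.

Hypothesis few : (#|arrow_set Q| < #|V|)%N.

(** There are so few arrows that every edge joins some vertex to its parent, and
    the vertex in question is the endpoint farther from [r]. *)
Lemma parent_of_adjacent u v : adjacent Q u v -> (d v <= d u)%N -> par u = v.
Proof.
move=> adj le_vu.
have : ((u, v) \in arrow_set Q) || ((v, u) \in arrow_set Q) by rewrite !inE.
have up w : w != r -> v = w -> u = par w -> par u = v.
  by case/parP=> _ + eq_vw eq_uw; rewrite -eq_uw -eq_vw ltnNge le_vu.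
have <- : parent_edge @: [set~ r] = arrow_set Q.
  apply/eqP; rewrite eqEcard sub_parent_edges card_parent_edges -ltnS.
  by rewrite (leq_trans few (leqSpred _)).
by case/orP=> /imsetP[w]; rewrite !inE => w_r; rewrite /parent_edge; case: ifP => _ [];
  by [move=> -> -> | move=> eq1 eq2; apply: (up w)].
Qed.

(** At a vertex of a cycle farthest from [r], both edges of the cycle lead to
    its parent, so its two neighbours on the cycle coincide. *)
Lemma ucycle_of_few_arrows (c : seq V) : ucycle (adjacent Q) c -> (size c <= 2)%N.
Proof.
case: c => [|x0 c] //; rewrite leqNgt => c_cyc; apply/negP => c_long.
have [x x_c x_max] := arg_maxnP d (mem_head x0 c).
have [i c' c_rot] := rot_to x_c.
move: c_cyc; rewrite -(rot_ucycle i) c_rot.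
move: c_long; rewrite -(size_rot i) c_rot.
have {}x_max y : y \in x :: c' -> (d y <= d x)%N.
  by rewrite -c_rot mem_rot; apply: x_max.
case: c' x_max {c_rot} => [|y c'] // x_max.
case/lastP: c' x_max => [|c' z] // x_max _.
case/andP=> /= /andP[xy]; rewrite rcons_path last_rcons => /andP[_ zx].
have py : par x = y.
  by apply: parent_of_adjacent => //; apply: x_max; rewrite !inE eqxx orbT.
have pz : par x = z.
  apply: parent_of_adjacent; first by rewrite /adjacent /= orbC.
  by apply: x_max; rewrite !inE mem_rcons inE eqxx !orbT.
by rewrite -py pz mem_rcons mem_head /= andbF.
Qed.

End ParentEdges.

Lemma connected_is_tree (V : finType) (Q : quiver V) :
  connected Q -> (\sum_u \sum_v Q u v ^ 2 < #|V|)%N -> is_tree Q.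
Proof.
move=> connQ; have [/card_gt0P[r _] /(_ r) conn] := connQ => few.
have [d [par parP]] := connect_parent conn.
have [le_sqr eq_sqr] := arrow_leqif_sqr Q.
split=> // [c|u v].
  by apply: (ucycle_of_few_arrows parP); apply: leq_ltn_trans few.
(* The parent edges alone number [#|V| - 1], so the bound on the sum of squares
   is attained. *)
suff /forallP/(_ (u, v)) : [forall p : V * V, Q p.1 p.2 <= 1]%N by [].
rewrite -eq_sqr eqn_leq le_sqr /= -ltnS (leq_trans few) // (leq_trans (leqSpred _)) //.
by rewrite ltnS -(card_parent_edges parP) subset_leq_card // (sub_parent_edges parP).
Qed.

(** * Finiteness *)

Section Pullback.
Variables (V W : finType) (f : W -> V) (Q : quiver V).

Definition pullback_arrows : {ffun W -> {ffun W -> nat}} :=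
  [ffun x => [ffun y => Q (f x) (f y)]].

Fact pullback_subproof :
  [forall x, forall y,
     (pullback_arrows x y == 0)%N || (pullback_arrows y x == 0)%N].
Proof.
apply/forallP => x; apply/forallP => y; rewrite !ffunE.
by case: Q => a /= /forallP/(_ (f x))/forallP/(_ (f y)).
Qed.

Definition pullback : quiver W := Quiver pullback_subproof.

Lemma pullbackE x y : pullback x y = Q (f x) (f y).
Proof. by rewrite /= !ffunE. Qed.

End Pullback.

Lemma bounded_quivers_finite (N M : nat) :
  exists s : seq {n : nat & quiver 'I_n},
  forall n (Q : quiver 'I_n), (n <= N)%N -> (forall u v, Q u v <= M)%N ->
    existT _ n Q \in s.
Proof.
pose to_nat n (g : {ffun 'I_n -> {ffun 'I_n -> 'I_M.+1}}) :
    {ffun 'I_n -> {ffun 'I_n -> nat}} := [ffun u => [ffun v => val (g u v)]].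
pose quivers n : seq (quiver 'I_n) := pmap insub [seq to_nat n g | g : _].
exists [seq existT _ n Q | n <- iota 0 N.+1, Q <- quivers n] => n Q le_nN le_QM.
apply/allpairsPdep; exists n, Q; split=> //; first by rewrite mem_iota.
rewrite mem_pmap_sub; apply/imageP.
exists [ffun u => [ffun v => inord (Q u v)]] => //.
by apply/ffunP => u; apply/ffunP => v; rewrite !ffunE /= inordK ?ltnS.
Qed.

Lemma mult_le_abs_markov (V : finType) (Q : quiver V) :
  acyclic Q -> (\sum_u \sum_v Q u v ^ 2 <= `|markov Q|)%N.
Proof.
by move/sum_sqr_le_markov=> le_sqr; rewrite -lez_nat (le_trans le_sqr) ?lez_abs.
Qed.

Lemma finitely_many_fixed_card (k : int) (n : nat) :
  finitely_many_modulo quiver_iso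
    (fun V Q => [/\ #|V| = n, acyclic Q & markov Q = k]).
Proof.
have [s sP] := bounded_quivers_finite n `|k|.
exists s => V Q [cardV /mult_le_abs_markov le_sqr markQ].
exists (existT _ #|V| (pullback enum_val Q)).
  apply: sP; first by rewrite cardV.
  by move=> u v; rewrite pullbackE -markQ (leq_trans (mult_le_sqr _ _ _)).
exists enum_val; first exact: enum_val_bij.
by move=> u v; rewrite pullbackE.
Qed.

(** The degree of the polynomial is the number of vertices, and then its
    coefficient below the leading one determines the Markov invariant. *)
Lemma finitely_many_alexander (p : {poly int}) :
  finitely_many_modulo quiver_iso (fun V Q => acyclic Q /\ alexander Q = p).
Proof.
pose n := (size p).-1.
have [s sP] :=
  finitely_many_fixed_card (n%:Z + (if n is m.+1 then p`_m else 0)) n.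
exists s => V Q [acyc alexQ]; apply: sP.
have nE : n = #|V| by rewrite /n -alexQ size_alexander.
by split=> //; rewrite /markov alexQ nE.
Qed.

Definition nonisolated (V : finType) (Q : quiver V) : {set V} :=
  [set v | [exists u, adjacent Q u v]].

Lemma card_nonisolated (V : finType) (Q : quiver V) :
  (#|nonisolated Q| <= (\sum_u \sum_v Q u v ^ 2).*2)%N.
Proof.
have sub : nonisolated Q \subset (fst @: arrow_set Q) :|: (snd @: arrow_set Q).
  apply/subsetP => v; rewrite inE => /existsP[u /orP[uv|vu]]; rewrite inE.
    by apply/orP; right; apply/imsetP; exists (u, v); rewrite ?inE.
  by apply/orP; left; apply/imsetP; exists (v, u); rewrite ?inE.
apply: leq_trans (subset_leq_card sub) _; rewrite -addnn.
apply: leq_trans (leq_card_setU _ _) _.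
by apply: leq_add; apply: leq_trans (leq_imset_card _ _) (arrow_leqif_sqr Q).
Qed.

(** The restriction of [Q] to its non-isolated vertices, of which there are at
    most [2 |k|], is one of finitely many quivers. *)
Lemma finitely_many_markov (k : int) :
  finitely_many_modulo adds_isolated (fun V Q => acyclic Q /\ markov Q = k).
Proof.
have [s sP] := bounded_quivers_finite `|k|.*2 `|k|.
exists s => V Q [/mult_le_abs_markov le_sqr markQ]; rewrite markQ in le_sqr.
pose f : 'I_#|nonisolated Q| -> V := enum_val.
exists (existT _ #|nonisolated Q| (pullback f Q)).
  apply: sP => [|u v]; last by rewrite pullbackE (leq_trans (mult_le_sqr _ _ _)).
  by apply: leq_trans (card_nonisolated Q) _; rewrite leq_double.
exists f; split=> [|u v|x y xy]; [exact: enum_val_inj | by rewrite pullbackE |].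
have in_codom v : v \in nonisolated Q -> v \in codom f.
  by move=> vS; rewrite -(enum_rankK_in vS vS) codom_f.
split; apply: in_codom; rewrite inE; apply/existsP.
  by exists y; rewrite /adjacent /= xy orbT.
by exists x; rewrite /adjacent /= xy.
Qed.

Theorem corollary6p7 :
  [/\ forall k : int,
        finitely_many_modulo adds_isolated
          (fun V Q => acyclic Q /\ markov Q = k),
      forall (k : int) (n : nat),
        finitely_many_modulo quiver_iso
          (fun V Q => [/\ #|V| = n, acyclic Q & markov Q = k]),
      forall p : {poly int},
        finitely_many_modulo quiver_iso
          (fun V Q => acyclic Q /\ alexander Q = p)
    & forall (V : finType) (Q : quiver V),
        acyclic Q -> markov Q = #|V|%:Z - 1 -> connected Q ->
        exists Q' : quiver V, mutation_equivalent Q Q' /\ is_tree Q'].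
Proof.
split=> [k|k n|p|V Q acyc markQ conn].
- exact: finitely_many_markov.
- exact: finitely_many_fixed_card.
- exact: finitely_many_alexander.
exists Q; split; first by exists [::].
apply: connected_is_tree => //; have := sum_sqr_le_markov acyc.
by rewrite markQ lerBrDr -PoszD lez_nat addn1.
Qed.
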